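(* Let $T$ be an invertible measure preserving transformation on a probability space $(\Omega,\Sigma,\mu)$ with index $N_T\in[1,\infty]$, and let $C_T^\ast$ be the associated Tauberian constant function. Then: (i) If $N_T=1$, then $C_T^\ast(\alpha)=1$ for all $\alpha\in[0,1)$, and thus $C_T^\ast\in C^\infty(0,1)$. (ii) If $N_T=\infty$, then $C_T^\ast(\alpha)=\frac{2}{\alpha}-1$ for all $\alpha\in(0,1)$, and thus $C_T^\ast\in C^\infty(0,1)$. (iii) If $1<N_T<\infty$, then $C_T^\ast$ is discontinuous as a function on $(0,1)$.
   Context: Index: if for every positive integer $N$ there exists a measurable set $A\subset\Omega$ with $\mu(A)>0$ such that the sets $A,TA,\ldots,T^NA$ are pairwise disjoint, then $N_T=\infty$. Otherwise $N_T$ is the largest positive integer for which there exists a measurable set $A\subset\Omega$ with $\mu(A)>0$ such that the sets $A,TA,\ldots,T^{N_T-1}A$ are pairwise disjoint. Maximal operator and Tauberian constant: for $f$ on $\Omega$, $$T^\ast f(\omega)=\sup_{M\le 0\le N,\ M,N\in\mathbb{Z}}\frac{1}{N-M+1}\sum_{j=M}^N|f(T^j\omega)|,$$ and for $\alpha\in[0,1)$ $$C_T^\ast(\alpha)=\sup_{E\in\Sigma,\ \mu(E)>0}\frac{1}{\mu(E)}\mu(\{\omega\in\Omega: T^\ast\chi_E(\omega)>\alpha\}),$$ where $\chi_E$ is the indicator function of $E$. *)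

(* Defs.v *)
From mathcomp Require Export all_boot all_order all_algebra.
From mathcomp Require Export all_classical all_reals all_analysis.
Set Implicit Arguments.
Unset Strict Implicit.
Unset Printing Implicit Defensive.
Export Order.TTheory GRing.Theory Num.Theory.
Export numFieldNormedType.Exports.
#[export] Set Warnings "-notation-overridden".
Global Open Scope classical_set_scope.
Global Open Scope ring_scope.

Record invertible_mpt d (R : realType) (Omega : measurableType d)
    (mu : probability Omega R) := InvertibleMpt {
  mpt_fun :> Omega -> Omega;
  mpt_inv : Omega -> Omega;
  mpt_funK : cancel mpt_fun mpt_inv;
  mpt_invK : cancel mpt_inv mpt_fun;
  mpt_measurable : measurable_fun setT mpt_fun;
  mpt_inv_measurable : measurable_fun setT mpt_inv;
  mpt_preserving :
    forall A, measurable A -> pushforward mu mpt_fun A = mu A }.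

Section TauberianConstant.
Context d (R : realType) (Omega : measurableType d) (mu : probability Omega R).
Variable T : invertible_mpt mu.

(* A, T A, ..., T^(n-1) A are pairwise disjoint: there are n sets. *)
Definition has_tower (n : nat) : Prop :=
  exists A : set Omega, [/\ measurable A, (0 < mu A)%E &
    trivIset `I_n (fun i => iter i T @` A)].

Definition largest_tower (n : nat) : Prop :=
  [/\ (0 < n)%N, has_tower n & forall m, has_tower m -> (m <= n)%N].

Definition index : \bar R :=
  if `[< forall N, (0 < N)%N -> has_tower N.+1 >] then +oo%E
  else (get largest_tower)%:R%:E.

Lemma has_tower1 : has_tower 1.
Proof.
exists setT; split => //; first by rewrite probability_setT.
by move=> i j /=; rewrite !ltnS !leqn0 => /eqP -> /eqP ->.
Qed.

Lemma has_tower_le m n : (m <= n)%N -> has_tower n -> has_tower m.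
Proof.
move=> mn [A [mA A0 tA]]; exists A; split => //.
by move=> i j im jm; apply: tA => /=; apply: leq_trans mn.
Qed.

(* [get] is only applied to an inhabited predicate in [index]. *)
Lemma largest_tower_get :
  ~ (forall N, (0 < N)%N -> has_tower N.+1) -> largest_tower (get largest_tower).
Proof.
move=> /existsNP[N /not_implyP[N0 NN]].
apply: getPex.
have ex : exists n, `[< has_tower n >] by exists 1%N; apply/asboolP/has_tower1.
have ub n : `[< has_tower n >] -> (n <= N)%N.
  move=> /asboolP tn; rewrite leqNgt; apply/negP => Nn.
  exact/NN/(has_tower_le Nn).
case: (ex_maxnP ex ub) => n /asboolP tn nmax.
have nm m : has_tower m -> (m <= n)%N by move=> tm; apply/nmax/asboolP.
by exists n; split => //; exact/nm/has_tower1.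
Qed.

Definition iterz (j : int) : Omega -> Omega :=
  match j with
  | Posz n => iter n T
  | Negz n => iter n.+1 (mpt_inv T)
  end.

(* The sum over M <= j <= N is reindexed as j = M + k with 0 <= k <= N - M. *)
Definition ergodic_average (f : Omega -> R) (M N : int) (w : Omega) : R :=
  (N - M + 1)%:~R^-1 * \sum_(k < `|N - M|%N.+1) `|f (iterz (M + k%:Z) w)|.

Definition ergodic_maximal (f : Omega -> R) (w : Omega) : \bar R :=
  ereal_sup [set x | exists M N : int,
    [/\ M <= 0, 0 <= N & x = (ergodic_average f M N w)%:E]].

Definition tauberian (alpha : R) : \bar R :=
  ereal_sup [set x | exists E : set Omega, [/\ measurable E, (0 < mu E)%E &
    x = (mu [set w | alpha%:E < ergodic_maximal \1_E w] / mu E)%E]].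

End TauberianConstant.

Definition smooth_on (R : realType) (D : set R) (C : R -> \bar R) : Prop :=
  (forall x, D x -> C x \is a fin_num) /\
  (forall (n : nat) x, D x -> derivable (derive1n n (fine \o C)) x 1).

(* Main.v *)
(** Write [T*] for the maximal operator and [N] for the index.

    The discontinuity (iii) sits at [alpha0 = (2N-2)/(2N-1)].  If no tower of height
    [N+1] exists, then for every [E] the points outside [E] whose next [N] (or
    previous [N]) iterates all lie in [E] form a null set, because that set is the
    base of a tower of height [N+1].  Hence, almost everywhere outside [E], on
    either side of the orbit each point outside [E] is followed by at most [N-1]
    consecutive points of [E], so no window has density above [alpha0] and
    [C*(alpha) = 1] for [alpha >= alpha0].  For [N = 1] this is (i).  Conversely let
    [A] be the base of a tower of height [N]; then [A = T^N A] almost everywhere,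
    the set [E] of the other [N-1] levels has density [alpha0] in the window of
    radius [N-1] around a point of [A], and [C*(alpha) >= N/(N-1)] for
    [alpha < alpha0].

    In (ii) the upper bound is transferred from a covering lemma on integer
    intervals: a greedy selection of windows covers each point at most twice, and a
    point covered twice costs [1/alpha] but covers [1] less, which turns [2/alpha]
    into [2/alpha - 1].  The lower bound takes for [E] a block of [k] consecutive
    levels in the middle of a tall tower. *)
Require Import Defs.
From mathcomp Require Import measurable_realfun ring lra zify.

Set Implicit Arguments.
Unset Strict Implicit.
Unset Printing Implicit Defensive.

(** * Densities in windows of integers *)

(** The window is cut at successive gaps, the places where [e] fails: each piece starts with a gap
    and has length at most [N]. Strong induction on [b] removes the first piece. *)
Lemma density_of_gaps (e : nat -> bool) (N b : nat) :
  ~~ e 0 ->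
  (forall i, ~~ e i -> exists2 j, (0 < j <= N)%N & ~~ e (i + j)%N) ->
  (N * \sum_(i < b) e i <= N.-1 * b)%N.
Proof.
elim/ltn_ind: b e => b IH e e0 he.
(* For [c > 0] there are at most [c - 1] hits, and [N(c - 1) <= (N - 1)c] amounts to [c <= N]. *)
have block c : (c <= N)%N -> (N * \sum_(i < c) e i <= N.-1 * c)%N.
  case: c => [|c] cN; first by rewrite big_ord0; lia.
  rewrite big_ord_recl (negbTE e0) add0n.
  have : (\sum_(i < c) e (lift ord0 i) <= c)%N.
    rewrite -[leqRHS]muln1 -[in leqRHS](card_ord c) -sum_nat_const.
    by apply: leq_sum => i _; case: (e _).
  nia.
have [bN|Nb] := leqP b N; first exact: block.
have [j /andP[j0 jN]] := he _ e0; rewrite add0n => ej.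
have bj : (b = j + (b - j))%N by lia.
rewrite bj big_split_ord/= mulnDr mulnDr leq_add ?block//.
apply: (IH (b - j)%N ltac:(by lia) (fun i => e (j + i)%N)); first by rewrite addn0.
by move=> i /he[k kN ek]; exists k; rewrite ?addnA.
Qed.

Section covering.
Variables (R : realFieldType) (alpha : R) (e G : nat -> bool) (n : nat).
Hypothesis alpha01 : 0 < alpha < 1.

Let S a b : R := \sum_(a <= i < b) (e i)%:R.

Hypothesis G_covered : forall p, G p ->
  exists a b, [/\ (a <= p)%N, (p < b <= n)%N & alpha * (b - a)%:R < S a b].

Let S_ge0 a b : 0 <= S a b. Proof. exact: sumr_ge0. Qed.

Let S_cat a b c : (a <= b)%N -> (b <= c)%N -> S a c = S a b + S b c.
Proof. by move=> ab bc; rewrite /S (big_cat_nat _ bc). Qed.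

Let sum_bool_le (f : nat -> bool) a b :
  (a <= b)%N -> \sum_(a <= i < b) (f i)%:R <= (b - a)%:R :> R.
Proof.
move=> ab; rewrite -sumr_const_nat.
by apply: ler_sum => i _; case: (f i).
Qed.

(* Greedy selection: [b1 <= b2] are the right ends of the last two selected
   intervals.  The next selected interval starts after [b1], so its overlap with
   the points already covered lies in [b1, b2), and these overlaps are disjoint. *)
Let greedy b1 b2 : (b1 <= b2)%N ->
  (forall a b, (a < b1)%N -> (b <= n)%N -> alpha * (b - a)%:R < S a b ->
     (b <= b2)%N) ->
  \sum_(b2 <= i < n) (G i)%:R <= alpha^-1 * S b2 n + (alpha^-1 - 1) * S b1 n.
Proof.
case/andP: alpha01 => a0 a1.
have beta1 : 1 < alpha^-1 by rewrite invf_gt1.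
have [c hc] := ubnP (n - b2)%N.
elim: c b1 b2 hc => // c IH b1 b2 hc b12 inv.
have [nb2|b2n] := leqP n b2.
  rewrite big_geq// addr_ge0// mulr_ge0 ?S_ge0 ?invr_ge0 ?subr_ge0 ?(ltW a0)//.
  exact: ltW.
(* Candidates: right ends beyond [b2] of dense windows that start no later than [b2]. *)
pose P b := [&& (b2 < b)%N, (b <= n)%N &
  [exists a : 'I_b2.+1, alpha * (b - a)%:R < S a b]].
have [exP|nP] := pselect (exists b, P b); last first.
  (* Without a candidate no dense window covers [b2], and the scan advances by one point. *)
  have Gb2 : G b2 = false.
    apply/negP => /G_covered[a [b [ab2 /andP[b2b bn] ab]]]; apply: nP.
    exists b; rewrite /P b2b bn/=; apply/existsP.
    by exists (Ordinal (ab2 : (a < b2.+1)%N)).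
  rewrite big_ltn// Gb2 add0r.
  have inv' a b : (a < b2)%N -> (b <= n)%N -> alpha * (b - a)%:R < S a b ->
      (b <= b2.+1)%N.
    move=> ab2 bn ab; rewrite leqNgt; apply/negP => b2b; apply: nP.
    exists b; rewrite /P bn (ltnW b2b)/=; apply/existsP.
    by exists (Ordinal (ltnW ab2 : (a < b2.+1)%N)).
  apply: (le_trans (IH b2 b2.+1 ltac:(lia) (leqnSn _) inv')).
  rewrite (S_cat b12 (ltnW b2n)) (@S_cat b2 b2.+1 n)//.
  have := S_ge0 b1 b2; have := S_ge0 b2 b2.+1; have := S_ge0 b2.+1 n; nra.
have Pn b : P b -> (b <= n)%N by case/and3P.
case: (ex_maxnP exP Pn) => b3 /and3P[b23 b3n /existsP[[a3 /=]]].
rewrite ltnS => a3b2 pos3 b3max.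
(* Maximality of [b3] renews the invariant for the pair [b2], [b3]. *)
have inv' a b : (a < b2)%N -> (b <= n)%N -> alpha * (b - a)%:R < S a b ->
    (b <= b3)%N.
  move=> ab2 bn ab; have [bb2|b2b] := leqP b b2; first lia.
  apply: b3max; rewrite /P b2b bn/=; apply/existsP.
  by exists (Ordinal (ltnW ab2 : (a < b2.+1)%N)).
have b1a3 : (b1 <= a3)%N.
  by rewrite leqNgt; apply/negP => /inv /(_ b3n pos3); lia.
rewrite (big_cat_nat _ b3n)//=; last exact: ltnW.
have := IH b2 b3 ltac:(by lia) (ltnW b23) inv'.
have := sum_bool_le G (ltnW b23).
rewrite (S_cat b12 (ltnW b2n)) (S_cat b1a3 a3b2) (@S_cat b2 b3 n)//; last exact: ltnW.
move: pos3; rewrite (S_cat a3b2 (ltnW b23)) => pos3.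
have := sum_bool_le e a3b2; rewrite -/(S a3 b2).
have := S_ge0 b1 a3; have := S_ge0 b2 b3; have := S_ge0 b3 n.
have E : (b3 - a3)%:R = (b2 - a3)%:R + (b3 - b2)%:R :> R.
  by rewrite -natrD; congr _%:R; lia.
move: pos3; rewrite E.
set o := (b2 - a3)%:R; set m := (b3 - b2)%:R.
(* Density reads [o + m < (Eo + En) / alpha]; since [Eo <= o], the [m] new points cost less than
   [(1/alpha - 1) Eo + En / alpha]. *)
rewrite -ltr_pdivlMl//.
move: (S a3 b2) => Eo; move: (S b1 a3) => E1; move: (S b2 _) => En; move: (S _ n) => E3.
nra.
Qed.

(** The selection starts with both ends at [0], where the invariant is vacuous; the two sums then
    coincide and their coefficients add up to [2 / alpha - 1]. *)
Lemma maximal_density_bound :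
  \sum_(0 <= i < n) (G i)%:R <= (2 / alpha - 1) * \sum_(0 <= i < n) (e i)%:R.
Proof.
have := @greedy 0%N 0%N (leqnn _) (fun a b H => False_ind _ (notF H)).
by rewrite -mulrDl; congr (_ <= _ * _); ring.
Qed.

End covering.

(** * Orbits and windows *)

Section dynamics.
Context d (R : realType) (Omega : measurableType d) (mu : probability Omega R).
Variable T : invertible_mpt mu.

Local Notation S := (mpt_inv T).
Local Notation TK := (mpt_funK T).
Local Notation SK := (mpt_invK T).

Lemma iter_mpt_funK n : cancel (iter n T) (iter n S).
Proof. by elim: n => [|n IH] w //=; rewrite -iterS iterSr /= TK IH. Qed.

Lemma iter_mpt_invK n : cancel (iter n S) (iter n T).
Proof. by elim: n => [|n IH] w //=; rewrite -iterS iterSr /= SK IH. Qed.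

Lemma iter_mpt_inv_sub m n w : (n <= m)%N ->
  iter n T (iter m S w) = iter (m - n) S w.
Proof. by move=> nm; rewrite -{1}(subnKC nm) iterD iter_mpt_invK. Qed.

Lemma iter_mpt_fun_sub m n w : (m <= n)%N ->
  iter n T (iter m S w) = iter (n - m) T w.
Proof. by move=> mn; rewrite -{1}(subnK mn) iterD iter_mpt_invK. Qed.

Lemma image_iter_mpt n (A : set Omega) : iter n T @` A = iter n S @^-1` A.
Proof.
apply/seteqP; split => [_ [w Aw <-]|w Aw] /=; first by rewrite iter_mpt_funK.
by exists (iter n S w) => //; rewrite iter_mpt_invK.
Qed.

Lemma measurable_iter_mpt n : measurable_fun setT (iter n T).
Proof.
elim: n => [|n IH]; first exact: measurable_id.
exact: (measurableT_comp (mpt_measurable T)).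
Qed.

Lemma measurable_iter_mpt_inv n : measurable_fun setT (iter n S).
Proof.
elim: n => [|n IH]; first exact: measurable_id.
exact: (measurableT_comp (mpt_inv_measurable T)).
Qed.

Lemma measurable_preimage_iter n (A : set Omega) :
  measurable A -> measurable (iter n T @^-1` A).
Proof.
by move=> mA; rewrite -[X in measurable X]setTI; exact: measurable_iter_mpt.
Qed.

Lemma measurable_preimage_iter_inv n (A : set Omega) :
  measurable A -> measurable (iter n S @^-1` A).
Proof.
by move=> mA; rewrite -[X in measurable X]setTI; exact: measurable_iter_mpt_inv.
Qed.

Lemma mu_preimage_iter n (A : set Omega) :
  measurable A -> mu (iter n T @^-1` A) = mu A.
Proof.
elim: n => [//|n IH] mA.
transitivity (mu (T @^-1` (iter n T @^-1` A))).
  by congr (mu _); apply/seteqP; split => w; rewrite /= -iterS iterSr.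
have := mpt_preserving T (measurable_preimage_iter n mA).
by rewrite /pushforward => ->; exact: IH.
Qed.

Lemma mu_preimage_iter_inv n (A : set Omega) :
  measurable A -> mu (iter n S @^-1` A) = mu A.
Proof.
move=> mA; rewrite -(mu_preimage_iter n (measurable_preimage_iter_inv n mA)).
by congr (mu _); apply/seteqP; split => w; rewrite /= iter_mpt_funK.
Qed.

Lemma iterz_succ j w : iterz T (j + 1) w = T (iterz T j w).
Proof.
case: j => [n|[|n]].
- by have -> : Posz n + 1 = Posz n.+1 by lia.
- by rewrite /= SK.
- have -> : Negz n.+1 + 1 = Negz n by lia.
  by rewrite /= SK.
Qed.

Lemma iterz_window (m k : nat) w :
  iterz T (- m%:Z + k%:Z) w = iter k T (iter m S w).
Proof.
elim: k => [|k IH]; first by rewrite addr0; case: m.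
by rewrite -addn1 PoszD addrA iterz_succ IH addn1.
Qed.

(** The window from [-m] to [n] is traversed forward from its left end, so that only natural
    exponents occur. *)
Definition visits (E : set Omega) (m n : nat) (w : Omega) : nat :=
  \sum_(k < (m + n).+1) (iter k T (iter m S w) \in E).

Lemma visitsE (E : set Omega) m n w : visits E m n w =
  (\sum_(i < m) (iter i.+1 S w \in E) + \sum_(i < n.+1) (iter i T w \in E))%N.
Proof.
rewrite /visits -addnS big_split_ord /=; congr (_ + _)%N.
  rewrite (reindex_inj rev_ord_inj)/=; apply: eq_bigr => i _.
  by rewrite iter_mpt_inv_sub ?leq_subr// subKn// ltn_ord.
by apply: eq_bigr => i _; rewrite iter_mpt_fun_sub ?leq_addr// addKn.
Qed.

Lemma ergodic_average_indic (E : set Omega) (m n : nat) w :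
  ergodic_average T (\1_E : Omega -> R) (- m%:Z) n%:Z w =
  (m + n).+1%:R^-1 * (visits E m n w)%:R.
Proof.
rewrite /ergodic_average opprK -PoszD addnC.
rewrite (_ : Posz (m + n)%N + 1 = Posz (m + n).+1); last by rewrite -addn1 PoszD.
congr (_ * _); rewrite /visits natr_sum; apply: eq_bigr => k _.
by rewrite iterz_window indicE normr_nat.
Qed.

(** A strict lower bound on a supremum is witnessed by one window; this makes the superlevel set a
    countable union of measurable sets. *)
Lemma ergodic_maximal_gt (E : set Omega) (alpha : R) w :
  (alpha%:E < ergodic_maximal T \1_E w)%E <->
  exists m n : nat, alpha * (m + n).+1%:R < (visits E m n w)%:R.
Proof.
split.
  move=> /ereal_sup_gt[_ [M [N [M0 N0 ->]]]].
  rewrite lte_fin (_ : M = - (`|M|%N)%:Z); last by lia.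
  rewrite (_ : N = (`|N|%N)%:Z); last by lia.
  rewrite ergodic_average_indic => h; exists `|M|%N, `|N|%N.
  by move: h; rewrite mulrC ltr_pdivlMr.
move=> [m [n h]]; apply/ereal_sup_gtP.
exists (ergodic_average T (\1_E : Omega -> R) (- m%:Z) n%:Z w)%:E.
  by exists (- m%:Z), n%:Z; split => //; lia.
by rewrite lte_fin ergodic_average_indic mulrC ltr_pdivlMr.
Qed.

Definition window_set (alpha : R) (E : set Omega) (m n : nat) : set Omega :=
  [set w | alpha * (m + n).+1%:R < (visits E m n w)%:R].

Lemma measurable_window_set alpha (E : set Omega) m n :
  measurable E -> measurable (window_set alpha E m n).
Proof.
move=> mE; rewrite -[X in measurable X]setTI.
have mv : measurable_fun setT (fun w => (visits E m n w)%:R : R).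
  rewrite (_ : (fun w => _) = fun w => \sum_(k < (m + n).+1)
      (\1_(iter m S @^-1` (iter k T @^-1` E)) w : R)).
    apply: measurable_sum => k; apply: measurable_indic.
    by apply: measurable_preimage_iter_inv; exact: measurable_preimage_iter.
  by apply/funext => w; rewrite /visits natr_sum.
rewrite (_ : window_set _ _ _ _ =
  (fun w => (visits E m n w)%:R : R) @^-1` `]alpha * (m + n).+1%:R, +oo[%classic).
  by apply: mv => //; exact: measurable_itv.
by apply/seteqP; split => w /=; rewrite in_itv/= andbT.
Qed.

Definition superlevel (alpha : R) (E : set Omega) : set Omega :=
  [set w | (alpha%:E < ergodic_maximal T \1_E w)%E].

Lemma superlevelE alpha (E : set Omega) :
  superlevel alpha E = \bigcup_m \bigcup_n window_set alpha E m n.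
Proof.
apply/seteqP; split => w.
  by move=> /ergodic_maximal_gt[m [n h]]; exists m => //; exists n.
by move=> [m _ [n _ h]]; apply/ergodic_maximal_gt; exists m, n.
Qed.

Lemma measurable_superlevel alpha (E : set Omega) :
  measurable E -> measurable (superlevel alpha E).
Proof.
move=> mE; rewrite superlevelE; apply: bigcupT_measurable => m.
by apply: bigcupT_measurable => n; exact: measurable_window_set.
Qed.

Lemma subset_superlevel alpha (E : set Omega) :
  alpha < 1 -> E `<=` superlevel alpha E.
Proof.
move=> a1 w Ew; apply/ergodic_maximal_gt; exists 0%N, 0%N.
by rewrite /visits big_ord1/= mem_set// mulr1.
Qed.

(** A set without returns within [N] steps has disjoint images up to time [N], so positive measure
    would make it the base of the excluded tower. *)
Lemma has_tower_null N (B : set Omega) : ~ has_tower T N.+1 -> measurable B ->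
  (forall w j, (0 < j <= N)%N -> B w -> ~ B (iter j T w)) -> mu B = 0%E.
Proof.
move=> nT mB hB; apply/eqP; rewrite -measure_le0 leNgt; apply/negP => B0; apply: nT.
exists B; split => // i j; rewrite /= !ltnS.
wlog ij : i j / (i <= j)%N => [H iN jN [w [Bi Bj]]|iN jN [w []]].
  case/orP: (leq_total i j) => ij; first by apply: H => //; exists w.
  by apply/esym; apply: H => //; exists w.
rewrite !image_iter_mpt /= => Bi Bj; apply/eqP; rewrite eqn_leq ij/= leqNgt.
(* The point [iter j S w] of [B] would return to [B] after [j - i] steps. *)
apply/negP => lij; apply: (hB (iter j S w) (j - i)%N _ Bj); first lia.
by rewrite iter_mpt_inv_sub ?leq_subr// subKn.
Qed.

End dynamics.

(** * Towers and the Tauberian constant *)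

Section dynamics.
Context d (R : realType) (Omega : measurableType d) (mu : probability Omega R).
Variable T : invertible_mpt mu.

Local Notation S := (mpt_inv T).

Lemma tauberian_le (alpha c : R) :
  (forall E, measurable E -> (mu (superlevel T alpha E) <= c%:E * mu E)%E) ->
  (tauberian T alpha <= c%:E)%E.
Proof.
move=> h; apply: ge_ereal_sup => _ [E [mE E0 ->]].
have := h E mE; rewrite /superlevel -(fineK (fin_num_measure mu _ mE)) => hE.
have e0 : 0 < fine (mu E) by rewrite -lte_fin (fineK (fin_num_measure mu _ mE)).
by rewrite inver gt_eqF// lee_pdivrMr.
Qed.

Lemma tauberian_ge (alpha c : R) (E : set Omega) :
  measurable E -> (0 < mu E)%E ->
  (c%:E * mu E <= mu (superlevel T alpha E))%E -> (c%:E <= tauberian T alpha)%E.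
Proof.
move=> mE E0 hE; apply: le_trans (ereal_sup_ubound _); last by exists E.
move: hE; rewrite /superlevel -(fineK (fin_num_measure mu _ mE)) => hE.
have e0 : 0 < fine (mu E) by rewrite -lte_fin (fineK (fin_num_measure mu _ mE)).
by rewrite inver gt_eqF// lee_pdivlMr.
Qed.

Lemma tauberian_ge1 (alpha : R) : alpha < 1 -> (1%:E <= tauberian T alpha)%E.
Proof.
move=> a1; apply: (@tauberian_ge _ _ setT) => //.
  by rewrite probability_setT.
rewrite mul1e le_measure ?inE//; first exact: measurable_superlevel.
exact: subset_superlevel.
Qed.

Definition block (A : set Omega) (a b : nat) : set Omega :=
  \bigcup_(i in [set i | (a <= i < b)%N]) iter i T @` A.

Lemma block_recr (A : set Omega) a b : (a <= b)%N ->
  block A a b.+1 = block A a b `|` iter b T @` A.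
Proof.
move=> ab; apply/seteqP; split => [w [i /= /andP[ai]]|w [[i /= /andP[ai ib] iw]|bw]].
- rewrite ltnS leq_eqVlt => /predU1P[->|ib] iw; [by right|left].
  by exists i => //=; rewrite ai.
- by exists i => //=; rewrite ai ltnS ltnW.
- by exists b => //=; rewrite ab ltnSn.
Qed.

Lemma measurable_image_iter n (A : set Omega) :
  measurable A -> measurable (iter n T @` A).
Proof. by rewrite image_iter_mpt; exact: measurable_preimage_iter_inv. Qed.

Lemma measurable_block (A : set Omega) a b :
  measurable A -> measurable (block A a b).
Proof. by move=> mA; apply: bigcup_measurable => i _; exact: measurable_image_iter. Qed.

Lemma mu_block (A : set Omega) H a b : measurable A ->
  trivIset `I_H (fun i => iter i T @` A) -> (a <= b <= H)%N ->
  mu (block A a b) = ((b - a)%:R%:E * mu A)%E.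
Proof.
move=> mA tA; elim: b => [|b IH] /andP[ab bH].
  rewrite sub0n mul0e /block (_ : [set _ | _] = set0) ?bigcup_set0 ?measure0//.
  by apply/seteqP; split => i //=; rewrite ltn0 andbF.
move: ab; rewrite leq_eqVlt => /predU1P[->|].
  rewrite subnn mul0e /block (_ : [set _ | _] = set0) ?bigcup_set0 ?measure0//.
  by apply/seteqP; split => i //=; lia.
rewrite ltnS => ab; rewrite block_recr//.
transitivity (mu (block A a b) + mu (iter b T @` A))%E; last first.
  rewrite IH; last by rewrite ab ltnW.
  rewrite subSn//.
  rewrite image_iter_mpt mu_preimage_iter_inv//.
  rewrite -natr1 EFinD.
  rewrite ge0_muleDl ?lee_fin//.
  by rewrite mul1e.
apply: measureU; [exact: measurable_block|exact: measurable_image_iter|].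
apply/seteqP; split => // w [[i /= /andP[_ ib] iw] bw].
have : i = b by apply: tA => //=; [exact: ltn_trans bH|exists w].
by move=> ib'; move: ib; rewrite ib' ltnn.
Qed.

Lemma le_measure_null_cover (A B Z : set Omega) : measurable A -> measurable B ->
  measurable Z -> mu Z = 0%E -> A `<=` B `|` Z -> (mu A <= mu B)%E.
Proof.
move=> mA mB mZ Z0 AB; rewrite -(measureU0 mB mZ Z0).
by apply: le_measure; rewrite ?inE//; exact: measurableU.
Qed.

(** * Consequences of the absence of a higher tower *)

Section no_higher_tower.
Variable k : nat.
Hypothesis noT : ~ has_tower T k.+2.

(** The family [f] consists of the powers of [T] or of its inverse, so that both time directions
    share one definition. *)
Definition isolated (f : nat -> Omega -> Omega) (E : set Omega) : set Omega :=
  ~` E `&` \bigcap_(j in [set j | (0 < j <= k.+1)%N]) f j @^-1` E.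

(** The next [k.+1] iterates of such a point lie in [E], hence are not isolated: there is no early
    return. *)
Let isolated_forward_null (E : set Omega) : measurable E ->
  measurable (isolated (fun j => iter j T) E) /\
  mu (isolated (fun j => iter j T) E) = 0%E.
Proof.
move=> mE; have mI : measurable (isolated (fun j => iter j T) E).
  apply: measurableI; first exact: measurableC.
  by apply: bigcap_measurableType => j _; exact: measurable_preimage_iter.
split => //; apply: (has_tower_null noT) => // w j jk [_ /(_ j jk) /= Ej] [].
by [].
Qed.

(** If [iter j T w] is isolated in the past, then [w] lies in [E] and is not isolated itself. *)
Let isolated_backward_null (E : set Omega) : measurable E ->
  measurable (isolated (fun j => iter j S) E) /\
  mu (isolated (fun j => iter j S) E) = 0%E.
Proof.
move=> mE; have mI : measurable (isolated (fun j => iter j S) E).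
  apply: measurableI; first exact: measurableC.
  by apply: bigcap_measurableType => j _; exact: measurable_preimage_iter_inv.
split => //; apply: (has_tower_null noT) => // w j jk [nE _] [_ /(_ j jk)] /=.
by rewrite iter_mpt_funK.
Qed.

(** Off this set, every gap met along the forward orbit is followed by another within [k.+1] steps,
    and likewise along the backward orbit. *)
Let exceptional (E : set Omega) : set Omega :=
  (\bigcup_i iter i T @^-1` isolated (fun j => iter j T) E) `|`
  (\bigcup_i iter i S @^-1` isolated (fun j => iter j S) E).

Let exceptional_null (E : set Omega) : measurable E ->
  measurable (exceptional E) /\ mu (exceptional E) = 0%E.
Proof.
move=> mE; have [mF F0] := isolated_forward_null mE.
have [mI I0] := isolated_backward_null mE.
have m1 i := measurable_preimage_iter T i mF.
have m2 i := measurable_preimage_iter_inv T i mI.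
have mX : measurable (exceptional E).
  by apply: measurableU; apply: bigcupT_measurable.
split => //; apply: (measure_negligible mX); apply: negligibleU.
  apply: negligible_bigcup => i; apply/negligibleP => //.
  by rewrite /= mu_preimage_iter.
apply: negligible_bigcup => i; apply/negligibleP => //.
by rewrite /= mu_preimage_iter_inv.
Qed.

(** Both half-orbits start at the gap [w], so the gap lemma applies to each of them, with [w]
    counted in both. *)
Let visits_le (E : set Omega) m n w : ~ E w -> ~ exceptional E w ->
  (k.*2.+1 * visits T E m n w <= k.*2 * (m + n).+1)%N.
Proof.
move=> nEw nX.
have gap (f : Omega -> Omega) :
  ~ (\bigcup_i iter i f @^-1` isolated (fun j => iter j f) E) w ->
  forall b, (k.+1 * \sum_(i < b) (iter i f w \in E) <= k * b)%N.
  move=> nf b; apply: (density_of_gaps (e := fun i => iter i f w \in E)).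
    by apply/negP; rewrite inE.
  move=> i /negP; rewrite inE => nEi; apply: contrapT => hi; apply: nf.
  exists i => //; split => //= j /= jk; apply: contrapT => nEj; apply: hi.
  by exists j => //; apply/negP; rewrite inE addnC iterD.
have gT := gap T (fun h => nX (or_introl h)) n.+1.
have := gap S (fun h => nX (or_intror h)) m.+1.
have w0 : (w \in E) = false by apply/negP; rewrite inE.
rewrite big_ord_recl /= w0 add0n => gS.
have : (\sum_(i < m) (iter i.+1 S w \in E) <= m)%N.
  rewrite -[leqRHS]muln1 -[in leqRHS](card_ord m) -sum_nat_const.
  by apply: leq_sum => i _; case: (_ \in _).
have : (\sum_(i < n.+1) (iter i T w \in E) <= n)%N.
  rewrite big_ord_recl /= w0 add0n.
  rewrite -[leqRHS]muln1 -[in leqRHS](card_ord n) -sum_nat_const.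
  by apply: leq_sum => i _; case: (_ \in _).
(* The sum of [(k+1)(a+b) <= k(m+n+2)] and [k] times [a+b <= m+n] is exactly the claim. *)
rewrite visitsE; move: gS gT; rewrite /bump /=.
move: (\sum_(i < m) _)%N (\sum_(i < n.+1) _)%N => a b; nia.
Qed.

Lemma tauberian_eq1 (alpha : R) :
  k.*2%:R <= alpha * k.*2.+1%:R -> alpha < 1 -> tauberian T alpha = 1%:E.
Proof.
move=> ka a1; apply/eqP; rewrite eq_le tauberian_ge1// andbT.
apply: tauberian_le => E mE; rewrite mul1e.
have [mX X0] := exceptional_null mE.
apply: (le_measure_null_cover _ mE mX X0); first exact: measurable_superlevel.
move=> w /ergodic_maximal_gt[m [n h]]; apply: contrapT => /not_orP[nE nX].
have := visits_le m n nE nX; rewrite -(ler_nat R) !natrM => v.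
have : (m + n).+1%:R * k.*2%:R <= (m + n).+1%:R * (alpha * k.*2.+1%:R) :> R.
  by rewrite ler_wpM2l.
have : alpha * (m + n).+1%:R * k.*2.+1%:R < (visits T E m n w)%:R * k.*2.+1%:R.
  by rewrite ltr_pM2r.
move: (k.*2.+1%:R : R) (k.*2%:R : R) ((m + n).+1%:R : R) v => x y z; lra.
Qed.

Lemma tauberian_ge_highest_tower (alpha : R) : (0 < k)%N -> has_tower T k.+1 ->
  alpha * k.*2.+1%:R < k.*2%:R ->
  ((k.+1%:R / k%:R)%:E <= tauberian T alpha)%E.
Proof.
move=> k0 [A [mA A0 tA]] ka.
have a1 : alpha < 1.
  have : k.*2%:R < k.*2.+1%:R :> R by rewrite ltr_nat.
  have : 0 < k.*2.+1%:R :> R by rewrite ltr0n.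
  move: ka; move: (k.*2.+1%:R : R) (k.*2%:R : R) => x y; nra.
have mE := measurable_block 1 k.+1 mA.
have tow i w : (0 < i < k.+1)%N -> A w -> ~ A (iter i T w).
  move=> /andP[i0 ik] Aw Ai; suff : i = 0%N by move=> i00; rewrite i00 in i0.
  by apply: tA => //=; exists (iter i T w); split => //; exists (iter i T w).
(* [B] is the part of [A] outside [T^(k+1) A]. It has no return in [k] steps by disjointness of the
   levels, nor at step [k.+1] by its definition, so it is null. *)
pose B := A `&` ~` (iter k.+1 S @^-1` A).
have mB : measurable B.
  apply: measurableI => //; apply: measurableC.
  exact: measurable_preimage_iter_inv.
have B0 : mu B = 0%E.
  apply: (has_tower_null noT) => // w j /andP[j0].
  rewrite leq_eqVlt => /predU1P[->|jk] [Aw nAw] [Aj nAj].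
    by apply: nAj; rewrite /= -iterS iter_mpt_funK.
  by apply: (tow j w) => //; rewrite j0.
have muE a : (a <= k.+1)%N -> mu (block A a k.+1) = ((k.+1 - a)%:R%:E * mu A)%E.
  by move=> ak; apply: (mu_block mA tA); rewrite ak leqnn.
apply: (@tauberian_ge _ _ (block A 1 k.+1)) => //.
  by rewrite muE// subn1 mule_gt0// lte_fin ltr0n.
rewrite muE// subn1 muleA -EFinM divfK ?pnatr_eq0 -?lt0n//.
rewrite -[X in X%:R%:E]subn0 -muE//.
apply: (le_measure_null_cover _ _ mB B0).
- exact: measurable_block.
- exact: measurable_superlevel.
move=> _ [i /= ik [w Aw <-]].
case: i ik => [_|i ik] /=; last first.
  by left; apply: subset_superlevel => //; exists i.+1 => //; exists w.
have [ASw|nASw] := pselect (A (iter k.+1 S w)); last by right.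
(* The [k] points before [w] are levels of the tower over [iter k.+1 S w], the [k] points after it
   levels over [w]: only the centre of the window misses the block. *)
left; apply/ergodic_maximal_gt; exists k, k.
rewrite addnn; apply: lt_le_trans ka _; rewrite ler_nat visitsE.
rewrite -addnn leq_add//.
  rewrite -[leqLHS]muln1 -[in leqLHS](card_ord k) -sum_nat_const.
  apply: leq_sum => i _; rewrite mem_set//.
  have ik := ltn_ord i.
  exists (k - i)%N => /=; first lia.
  exists (iter k.+1 S w) => //.
  rewrite iter_mpt_inv_sub; last lia.
  by have -> : (k.+1 - (k - i) = i.+1)%N by lia.
rewrite big_ord_recl; apply: leq_trans (leq_addl _ _).
rewrite -[leqLHS]muln1 -[in leqLHS](card_ord k) -sum_nat_const.
apply: leq_sum => i _; rewrite mem_set//.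
have ik := ltn_ord i.
by exists i.+1 => //=; exists w.
Qed.

End no_higher_tower.
End dynamics.

(** * The aperiodic case *)

Section dynamics.
Context d (R : realType) (Omega : measurableType d) (mu : probability Omega R).
Variable T : invertible_mpt mu.

Local Notation S := (mpt_inv T).

(** Windows around different points of one orbit become intervals of a common time axis, as the
    covering lemma requires. *)
Lemma visits_iter (E : set Omega) m n i w : (m <= i)%N ->
  visits T E m n (iter i T w) =
  (\sum_(i - m <= j < i + n.+1) (iter j T w \in E))%N.
Proof.
move=> mi; rewrite /visits -[(i - m)%N]add0n big_addn.
rewrite (_ : (i + n.+1 - (i - m))%N = (m + n).+1); last lia.
rewrite big_mkord; apply: eq_bigr => j _; rewrite iterD.
by rewrite -{1}(subnKC mi) iterD iter_mpt_funK.
Qed.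

Lemma measurable_orbit_count (F : set Omega) a b : measurable F ->
  measurable_fun setT
    (fun w => (\sum_(a <= i < b) (iter i T w \in F)%:R)%:E : \bar R).
Proof.
move=> mF; apply/measurable_EFinP.
apply: (@measurable_sum _ _ _ _ _ _ (fun i => \1_(iter i T @^-1` F))) => i.
by apply: measurable_indic; exact: measurable_preimage_iter.
Qed.

Lemma integral_orbit_count (F : set Omega) a b : measurable F ->
  (\int[mu]_w (\sum_(a <= i < b) (iter i T w \in F)%:R)%:E =
   (b - a)%:R%:E * mu F)%E.
Proof.
move=> mF; have mFi i := measurable_preimage_iter T i mF.
transitivity (\int[mu]_w (\sum_(a <= i < b)
    (\1_(iter i T @^-1` F) w : R)%:E))%E.
  by apply: eq_integral => w _; rewrite sumEFin.
rewrite (@ge0_integral_sum _ _ _ mu setT measurableT _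
  (fun i w => (\1_(iter i T @^-1` F) w : R)%:E)) => [|i|i w _] //; last first.
  by apply/measurable_EFinP; apply: measurable_indic.
transitivity (\sum_(a <= i < b) mu F)%E.
  apply: eq_bigr => i _; rewrite integral_indic// setIT.
  exact: mu_preimage_iter.
by rewrite -(fineK (fin_num_measure mu _ mF)) sumEFin sumr_const_nat -EFinM mulr_natl.
Qed.

(** The bound [L] keeps the windows around times in [[L, L + K)] inside [[0, K + 2L)]. *)
Definition bounded_superlevel alpha (E : set Omega) (L : nat) : set Omega :=
  \bigcup_(m in [set m | (m <= L)%N]) \bigcup_(n in [set n | (n <= L)%N])
    window_set T alpha E m n.

Lemma measurable_bounded_superlevel alpha (E : set Omega) L :
  measurable E -> measurable (bounded_superlevel alpha E L).
Proof.
move=> mE; apply: bigcup_measurable => m _; apply: bigcup_measurable => n _.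
exact: measurable_window_set.
Qed.

(** * Transference of the covering lemma to the space *)

Section upper_bound.
Variable alpha : R.
Hypothesis alpha01 : 0 < alpha < 1.

Lemma orbit_count_bound (E : set Omega) L K w :
  \sum_(L <= p < L + K) (iter p T w \in bounded_superlevel alpha E L)%:R <=
  (2 / alpha - 1) * \sum_(0 <= i < K + L.*2) (iter i T w \in E)%:R :> R.
Proof.
pose G p := (L <= p < L + K)%N && (iter p T w \in bounded_superlevel alpha E L).
apply: le_trans (@maximal_density_bound R alpha (fun i => iter i T w \in E) G
  (K + L.*2) alpha01 _).
  rewrite (big_cat_nat (leq0n L)); last lia.
  rewrite (big_cat_nat (leq_addr K L)); last lia.
  rewrite ler_wpDl ?sumr_ge0// ler_wpDr ?sumr_ge0//.
  by rewrite le_eqVlt; apply/orP; left; apply/eqP/eq_big_nat => p; rewrite /G => ->.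
move=> p /andP[/andP[Lp pLK]]; rewrite inE => -[m /= mL [n /= nL]].
rewrite /window_set /= visits_iter; last exact: leq_trans Lp.
move=> h; exists (p - m)%N, (p + n.+1)%N; split; [lia|lia|].
rewrite -natr_sum (_ : (p + n.+1 - (p - m))%N = (m + n).+1)//; lia.
Qed.

Let c_ge0 : 0 <= 2 / alpha - 1.
Proof.
case/andP: alpha01 => a0 a1; have : 1 < alpha^-1 by rewrite invf_gt1.
lra.
Qed.

(** Integrating the orbit inequality gives [K mu(G) <= c (K + 2L) mu(E)], where [G] is the bounded
    superlevel set; the boundary term [2L] disappears for large [K]. *)
Lemma mu_bounded_superlevel (E : set Omega) L : measurable E ->
  (mu (bounded_superlevel alpha E L) <= (2 / alpha - 1)%:E * mu E)%E.
Proof.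
move=> mE; have mG := measurable_bounded_superlevel alpha L mE.
have key (K : nat) : (K%:R%:E * mu (bounded_superlevel alpha E L) <=
    (2 / alpha - 1)%:E * ((K + L.*2)%:R%:E * mu E))%E.
  rewrite -{1}(addKn L K) -[(K + L.*2)%N]subn0.
  rewrite -!integral_orbit_count//.
  rewrite -ge0_integralZl//; last 2 first.
  - exact: measurable_orbit_count.
  - by move=> w _; rewrite lee_fin sumr_ge0.
  apply: ge0_le_integral => //.
  - by move=> w _; rewrite lee_fin sumr_ge0.
  - exact: measurable_orbit_count.
  - by apply: measurable_funeM; exact: measurable_orbit_count.
  - by move=> w _; rewrite -EFinM lee_fin orbit_count_bound.
move: key; rewrite -(fineK (fin_num_measure mu _ mG)) -(fineK (fin_num_measure mu _ mE)).
set g := fine _; set e := fine _; set c := _ - 1 => key.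
rewrite -EFinM lee_fin leNgt; apply/negP => ceg.
have e0 : 0 <= e by exact: fine_ge0.
(* Any [K] above this quotient contradicts [key] when [c * e < g]. *)
have : 0 <= c * L.*2%:R * e / (g - c * e).
  by rewrite !mulr_ge0// invr_ge0 subr_ge0 ltW.
move/archi_boundP.
rewrite ltr_pdivrMr ?subr_gt0//.
move: (key (Num.bound (c * L.*2%:R * e / (g - c * e)))).
rewrite -!EFinM lee_fin natrD; move: (_%:R : R) (_%:R : R) => x y; lra.
Qed.

(** The bound is uniform in [L], so it passes to the increasing union by continuity of the
    measure. *)
Lemma mu_superlevel_le (E : set Omega) : measurable E ->
  (mu (superlevel T alpha E) <= (2 / alpha - 1)%:E * mu E)%E.
Proof.
move=> mE.
have -> : superlevel T alpha E = \bigcup_L bounded_superlevel alpha E L.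
  rewrite superlevelE; apply/seteqP; split => w.
    move=> [m _ [n _ h]]; exists (m + n)%N => //.
    by exists m => /=; [exact: leq_addr|exists n => //=; exact: leq_addl].
  by move=> [L _ [m _ [n _ h]]]; exists m => //; exists n.
have mB L := measurable_bounded_superlevel alpha L mE.
have cv : (mu \o bounded_superlevel alpha E) L @[L --> \oo] -->
    mu (\bigcup_L bounded_superlevel alpha E L).
  apply: nondecreasing_cvg_mu => //; first exact: bigcupT_measurable.
  move=> L L' LL'; apply/subsetPset => w [m /= mL [n /= nL h]].
  exists m => /=; first exact: leq_trans LL'.
  by exists n => //=; exact: leq_trans LL'.
rewrite -(cvg_lim _ cv)//; apply: lime_le; first by apply/cvg_ex; eexists; exact: cv.
by apply: nearW => L; exact: mu_bounded_superlevel.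
Qed.

End upper_bound.

(** The block has [r] levels below and above it, with [r] the largest margin for which density
    [k / (r + k)] exceeds [alpha]. All [2r + k] levels lie in the superlevel set. *)
Lemma tauberian_ge_tower (alpha : R) (k : nat) :
  (forall n, has_tower T n) -> 0 < alpha < 1 -> (0 < k)%N ->
  ((2 / alpha - 1 - 2 / k%:R)%:E <= tauberian T alpha)%E.
Proof.
move=> tow /andP[a0 a1] k0.
have k0' : 0 < k%:R :> R by rewrite ltr0n.
pose P r := alpha * (r + k)%:R < k%:R.
have exP : exists r, P r by exists 0%N; rewrite /P add0n; nra.
have ubP r : P r -> (r <= Num.bound (k%:R / alpha))%N.
  rewrite /P mulrC -ltr_pdivlMr// => h.
  rewrite -(ler_nat R) ltW//; apply: lt_trans (archi_boundP _).
    by apply: le_lt_trans h; rewrite ler_nat leq_addr.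
  by rewrite divr_ge0// ltW.
case: (ex_maxnP exP ubP) => r Pr rmax.
have {}rmax : k%:R <= alpha * (r.+1 + k)%:R.
  by rewrite leNgt; apply/negP => /rmax; rewrite ltnn.
have [A [mA A0 tA]] := tow (r + k + r)%N.
have muB a b : (a <= b)%N -> (b <= r + k + r)%N ->
    mu (block T A a b) = ((b - a)%:R%:E * mu A)%E.
  by move=> ab bH; apply: (mu_block mA tA); rewrite ab bH.
have muE : mu (block T A r (r + k)) = (k%:R%:E * mu A)%E.
  by rewrite muB ?leq_addr// addKn.
have mE := measurable_block T r (r + k) mA.
apply: (tauberian_ge mE); first by rewrite muE mule_gt0 ?lte_fin.
apply: (@le_trans _ _ (mu (block T A 0 (r + k + r)))); last first.
  apply: le_measure; rewrite ?inE.
  - exact: measurable_block.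
  - exact: measurable_superlevel.
  move=> _ [i /= iH [w Aw <-]]; apply/ergodic_maximal_gt.
  have inE' j : (r <= j < r + k)%N -> (iter j T w \in block T A r (r + k)) = true.
    by move=> jr; rewrite mem_set//; exists j => //; exists w.
  have count a b : (a <= r)%N -> (r + k <= b)%N ->
      (k <= \sum_(a <= j < b) (iter j T w \in block T A r (r + k)))%N.
    move=> ar kb; rewrite (big_cat_nat ar)/=; last lia.
    rewrite (big_cat_nat (leq_addr k r) kb)/=.
    under [X in (_ + (X + _))%N]eq_big_nat => j jr do rewrite inE'//.
    by rewrite sum_nat_const_nat addKn muln1; lia.
  (* Up to the top of the block the window [[0, r + k)] is used, above it the window [[r, 2r + k)];
     both contain the block. *)
  have [irk|rki] := ltnP i (r + k).
    exists i, (r + k - i.+1)%N; rewrite visits_iter//.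
    rewrite (_ : (i + (r + k - i.+1)).+1 = r + k)%N; last lia.
    by apply: lt_le_trans Pr _; rewrite ler_nat count//; lia.
  exists (i - r)%N, (r + k + r - i.+1)%N; rewrite visits_iter ?leq_subr//.
  rewrite (_ : (i - r + (r + k + r - i.+1)).+1 = r + k)%N; last lia.
  by apply: lt_le_trans Pr _; rewrite ler_nat count//; lia.
rewrite muE muB// subn0 muleA -EFinM lee_wpmul2r// lee_fin.
(* Maximality of [r] gives [r / k >= 1/alpha - 1 - 1/k], which bounds the ratio [(2r + k) / k] from
   below. *)
have : k%:R / alpha <= (r.+1 + k)%:R by rewrite ler_pdivrMr// mulrC.
rewrite !natrD -natr1 !mulrBl mulfVK ?gt_eqF// mulrAC -!mulrA.
lra.
Qed.

Lemma tauberian_aperiodic (alpha : R) :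
  (forall n, has_tower T n) -> 0 < alpha < 1 ->
  tauberian T alpha = (2 / alpha - 1)%:E.
Proof.
move=> tow a01; apply/eqP; rewrite eq_le; apply/andP; split.
  by apply: tauberian_le => E mE; exact: mu_superlevel_le.
apply/lee_addgt0Pr => e e0.
have e20 : 0 <= 2 / e by rewrite divr_ge0// ltW.
have := archi_boundP e20; set k := Num.bound _ => hk.
have k0 : (0 < k)%N by rewrite -(ltr_nat R); exact: le_lt_trans hk.
have := tauberian_ge_tower tow a01 k0.
rewrite EFinB leeBlDr// => /le_trans; apply; rewrite leeD2l// lee_fin.
by rewrite ler_pdivrMr ?ltr0n// mulrC -ler_pdivrMr// ltW.
Qed.

End dynamics.

(** * Smoothness and the index *)

Lemma near_itv01 (R : realType) (x : R) :
  `]0, 1[%classic x -> \forall y \near x, `]0, 1[%classic y.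
Proof. by move=> x01; apply: open_nbhs_nbhs; split => //; exact: interval_open. Qed.

(** The derivative has the same shape, with constant term [0], so the induction on the order of
    differentiation can be closed. *)
Lemma is_derive_inv_power (R : realType) (F : R -> R) (a b : R) (k : nat) :
  (forall x : R, `]0, 1[%classic x -> F x = a * x^-1 ^+ k.+1 + b) ->
  forall x : R, `]0, 1[%classic x ->
    is_derive x 1 F (- a * k.+1%:R * x^-1 ^+ k.+2 + 0).
Proof.
move=> hF x x01; have x0 : x != 0.
  by move: x01; rewrite /= in_itv/= => /andP[/gt_eqF->].
have near_F : \forall y \near x, a * y^-1 ^+ k.+1 + b = F y.
  by near=> y; apply/esym/hF; near: y; exact: near_itv01.
apply: (near_eq_is_derive near_F).
have dV : is_derive x 1 (fun y : R => y^-1) (- x ^- 2 *: 1).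
  exact: is_deriveV.
have := is_deriveD (is_deriveZ a (is_deriveX k.+1 dV)) (is_derive_cst b x 1).
rewrite exprfctE => dF.
apply: (@is_derive_eq _ _ _ _ _ _ _ _ dF).
rewrite -exprVn /GRing.scale/= mulr1 !exprS; ring.
Unshelve. all: by end_near. Qed.

(** The form [a / x + b] covers both the constant [1], with [a = 0], and [2 / x - 1]. *)
Lemma smooth_on_inv (R : realType) (C : R -> \bar R) (a b : R) :
  (forall x : R, 0 < x < 1 -> C x = (a / x + b)%:E) -> smooth_on `]0, 1[ C.
Proof.
move=> hC.
have C01 (x : R) : `]0, 1[%classic x -> C x = (a / x + b)%:E.
  by rewrite /= in_itv/=; exact: hC.
split => [x /C01 ->//|n x x01].
have [k [a' [b' hk]]] : exists k a' b', forall x : R, `]0, 1[%classic x ->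
    derive1n n (fine \o C) x = a' * x^-1 ^+ k.+1 + b'.
  elim: n => [|n [k [a' [b' IH]]]].
    by exists 0%N, a, b => y /C01 Cy; rewrite /= Cy.
  exists k.+1, (- a' * k.+1%:R), 0 => y y01.
  rewrite derive1nS derive1E.
  by have [_ ->] := is_derive_inv_power IH y01.
by have [] := is_derive_inv_power hk x01.
Qed.

Lemma index_eq1 d (R : realType) (Omega : measurableType d)
    (mu : probability Omega R) (T : invertible_mpt mu) :
  index T = 1%E -> ~ has_tower T 2.
Proof.
rewrite /index; case: asboolP => // /largest_tower_get[_ _ h].
move: h; set N := get _ => h [/eqP]; rewrite pnatr_eq1 => /eqP N1 /h.
by rewrite N1.
Qed.

Lemma index_eq_infty d (R : realType) (Omega : measurableType d)
    (mu : probability Omega R) (T : invertible_mpt mu) :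
  index T = +oo%E -> forall n, has_tower T n.
Proof.
rewrite /index; case: asboolP => // h _ n.
(* The definition only speaks of heights at least [2]; height [n] is obtained from height
   [n + 2]. *)
by apply: (has_tower_le (leq_trans (leqnSn n) (leqnSn n.+1))); exact: h.
Qed.

Lemma index_gt1_finite d (R : realType) (Omega : measurableType d)
    (mu : probability Omega R) (T : invertible_mpt mu) :
  (1 < index T < +oo)%E ->
  exists k, [/\ (0 < k)%N, has_tower T k.+1 & ~ has_tower T k.+2].
Proof.
rewrite /index; case: asboolP => [_|/largest_tower_get[]]; first by rewrite ltxx andbF.
set N := get _ => N0 tN h; rewrite lte_fin ltr1n => /andP[N1 _].
exists N.-1; rewrite !prednK//; split => //; first by lia.
by move/h; rewrite ltnn.
Qed.

Theorem theorem2 (d : measure_display) (R : realType)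
    (Omega : measurableType d) (mu : probability Omega R)
    (T : invertible_mpt mu) :
  [/\ index T = 1%E ->
        (forall alpha : R, 0 <= alpha < 1 -> tauberian T alpha = 1%E) /\
        smooth_on `]0, 1[ (tauberian T),
      index T = +oo%E ->
        (forall alpha : R, 0 < alpha < 1 ->
           tauberian T alpha = (2 / alpha - 1)%:E) /\
        smooth_on `]0, 1[ (tauberian T)
    & (1 < index T < +oo)%E ->
        ~ {within `]0, 1[, continuous (tauberian T)}].
Proof.
split.
- move=> /index_eq1 noT2.
  have tau1 (alpha : R) : 0 <= alpha < 1 -> tauberian T alpha = 1%E.
    (* Here [k = 0], so the threshold is [0 <= alpha]. *)
    by move=> /andP[a0 a1]; apply: (tauberian_eq1 noT2); rewrite ?mulr1.
  split => //; apply: (@smooth_on_inv _ _ 0 1) => alpha /andP[a0 a1].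
  by rewrite mul0r add0r tau1// ltW.
- move=> /index_eq_infty tow.
  split; first by move=> alpha; exact: tauberian_aperiodic.
  by apply: (@smooth_on_inv _ _ 2 (-1)) => alpha; exact: tauberian_aperiodic.
- move=> /index_gt1_finite[k [k0 tow noT]] cont.
  pose alpha0 : R := k.*2%:R / k.*2.+1%:R.
  have d0 : 0 < k.*2.+1%:R :> R by rewrite ltr0n.
  have a00 : 0 < alpha0 by rewrite divr_gt0// ltr0n double_gt0.
  have a01 : alpha0 < 1 by rewrite ltr_pdivrMr// mul1r ltr_nat.
  have tau0 : tauberian T alpha0 = 1%E.
    by apply: (tauberian_eq1 noT); rewrite ?divfK// gt_eqF.
  have {}cont : tauberian T x @[x --> alpha0] --> 1%E.
    move: cont; rewrite continuous_open_subspace; last exact: interval_open.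
    by rewrite -tau0; apply; rewrite inE/= in_itv/= a00.
  have c1 : (1%:E < (k.+1%:R / k%:R : R)%:E)%E.
    by rewrite lte_fin ltr_pdivlMr ?ltr0n// mul1r ltr_nat.
  (* Continuity would keep the values near [alpha0] below [(k+1)/k], yet the point [alpha0 - e / 2]
     to its left has at least that value. *)
  have /nbhs_ballP[e /= e0 he] := cont _ (open_ereal_lt' c1).
  have : ball alpha0 e (alpha0 - e / 2).
    rewrite /ball /= opprB addrC subrK gtr0_norm ?divr_gt0//.
    by rewrite ltr_pdivrMr// ltr_pMr// ltr1n.
  move=> /he /=; apply/negP; rewrite -leNgt.
  apply: (tauberian_ge_highest_tower noT k0 tow).
  rewrite -ltr_pdivlMr// -/alpha0 ltrBlDr ltrDl divr_gt0//.
Qed.
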